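(* Let $p\ge 1$, $n=2^{p-1}$, and let $i,j\in\{0,1,\dots,2^p-1\}$ with $i\ne j$ have binary expansions $i=\sum_{k=0}^{p-1} i_k2^k$ and $j=\sum_{k=0}^{p-1} j_k2^k$, where $i_k,j_k\in\{0,1\}$. For $k\in\{0,\dots,p-1\}$ let $\sigma_k=\mathfrak{f}$ (in-shuffle) if $i_k\neq j_k$ and $\sigma_k=\mathfrak{g}$ (out-shuffle) if $i_k=j_k$. Then $$(\sigma_0\circ\sigma_1\circ\cdots\circ\sigma_{p-1})(j)=i\quad\text{and}\quad(\sigma_0\circ\sigma_1\circ\cdots\circ\sigma_{p-1})(i)=j.$$ That is, reading the bits from left (most significant) to right and performing an out-shuffle at each coincidence of bits and an in-shuffle at each difference of bits moves card $j$ to position $i$, and also moves card $i$ to position $j$.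
   Context: A deck of $2n=2^p$ cards occupies positions $0,1,\dots,2n-1$ from bottom to top. The maps $\mathfrak{f},\mathfrak{g}$ are the permutations of $\{0,\dots,2n-1\}$ giving the new position of the card in position $x$ after an in-shuffle and after an out-shuffle respectively: $\mathfrak{f}(x)=2x+1$ if $0\le x\le n-1$ and $\mathfrak{f}(x)=2x-2n$ if $n\le x\le 2n-1$; $\mathfrak{g}(x)=2x$ if $0\le x\le n-1$ and $\mathfrak{g}(x)=2x+1-2n$ if $n\le x\le 2n-1$. *)

(* Defs.v *)
From mathcomp Require Import all_boot all_fingroup.
From mathcomp Require Import zify.
Set Implicit Arguments.
Unset Strict Implicit.
Unset Printing Implicit Defensive.

Section Shuffles.

Variable n : nat.

(* For x : 'I_(2 * n) the truncated subtractions below are exact: in the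
   second branch n <= x, so 2 * n <= 2 * x. *)
Definition in_shuffle_pos (x : nat) : nat :=
  if x < n then 2 * x + 1 else 2 * x - 2 * n.

Definition out_shuffle_pos (x : nat) : nat :=
  if x < n then 2 * x else 2 * x + 1 - 2 * n.

Lemma in_shuffle_pos_lt (x : 'I_(2 * n)) : in_shuffle_pos x < 2 * n.
Proof. by rewrite /in_shuffle_pos; case: ifP; have := ltn_ord x; lia. Qed.

Lemma out_shuffle_pos_lt (x : 'I_(2 * n)) : out_shuffle_pos x < 2 * n.
Proof. by rewrite /out_shuffle_pos; case: ifP; have := ltn_ord x; lia. Qed.

Definition in_shuffle_fun (x : 'I_(2 * n)) : 'I_(2 * n) :=
  Ordinal (in_shuffle_pos_lt x).

Definition out_shuffle_fun (x : 'I_(2 * n)) : 'I_(2 * n) :=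
  Ordinal (out_shuffle_pos_lt x).

Lemma in_shuffle_inj : injective in_shuffle_fun.
Proof.
move=> x y /(congr1 val) /= H; apply: val_inj => /=; move: H.
by rewrite /in_shuffle_pos; case: ifP; case: ifP; lia.
Qed.

Lemma out_shuffle_inj : injective out_shuffle_fun.
Proof.
move=> x y /(congr1 val) /= H; apply: val_inj => /=; move: H.
by rewrite /out_shuffle_pos; case: ifP; case: ifP; lia.
Qed.

Definition in_shuffle : {perm 'I_(2 * n)} := perm in_shuffle_inj.

Definition out_shuffle : {perm 'I_(2 * n)} := perm out_shuffle_inj.

End Shuffles.

(* F 0 \o F 1 \o ... \o F p.-1, with F p.-1 applied first.  The group product
   of permutations composes in the opposite order (s * t applies s first), so
   the composition is taken on the underlying functions. *)
Definition comp_all (T : Type) (p : nat) (F : 'I_p -> T -> T) : T -> T :=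
  \big[(fun f g : T -> T => f \o g)/id]_(k < p) F k.

(* Main.v *)
Require Import Defs.
From mathcomp Require Import all_boot all_fingroup.
From mathcomp Require Import zify.

(** Each shuffle rotates the binary word of a position one step to the left,
    the in-shuffle complementing in addition the bit that wraps around. Hence,
    while the bits of a card are rotated out, most significant first, the bits
    of the target are rotated in: the bit that wraps around is complemented
    exactly when the two words disagree there. *)

Lemma comp_all_recl (T : Type) (q : nat) (F : 'I_q.+1 -> T -> T) (x : T) :
  comp_all F x = F ord0 (comp_all (fun k => F (lift ord0 k)) x).
Proof. by rewrite /comp_all big_ord_recl. Qed.

Lemma bits_recl (q : nat) (b : 'I_q.+1 -> bool) :
  \sum_(k < q.+1) b k * 2 ^ k = b ord0 + 2 * \sum_(k < q) b (lift ord0 k) * 2 ^ k.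
Proof.
rewrite big_ord_recl muln1 big_distrr; congr (_ + _).
by apply: eq_bigr => k _; rewrite lift0 expnS mulnCA.
Qed.

Lemma bits_lt (q : nat) (b : 'I_q -> bool) : \sum_(k < q) b k * 2 ^ k < 2 ^ q.
Proof.
elim: q b => [|q IHq] b; first by rewrite big_ord0.
by rewrite bits_recl expnS; have := IHq (fun k => b (lift ord0 k)); case: (b ord0); lia.
Qed.

(** When [n] is a power of two, [a] is the leading bit of [y] and [z] the rest. An out-shuffle
    appends [a] below [z], an in-shuffle [~~ a]; by the choice made, this bit is [c]. *)
Lemma shuffle_topbit (n : nat) (a c : bool) (z : nat) (y : 'I_(2 * n)) :
  z < n -> nat_of_ord y = a * n + z ->
  (if a == c then out_shuffle n else in_shuffle n) y = 2 * z + c :> nat.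
Proof.
move=> ltzn y_eq; case: eqP => [<-|ac]; rewrite permE /= ?/out_shuffle_pos ?/in_shuffle_pos y_eq.
  by case: a {y_eq} => /=; case: ifP; lia.
by case: a c ac {y_eq} => [] [] //= _; case: ifP; lia.
Qed.

(* The low word [Y] is arbitrary so that in the induction, which peels off the
   shuffle performed last, it can absorb the bit [a ord0] wrapped around by
   that shuffle. *)
Lemma shuffles_replace_bits (n q r Y : nat) (a c : 'I_q -> bool)
    (sigma : 'I_q -> {perm 'I_(2 * n)}) (x : 'I_(2 * n)) :
  2 * n = 2 ^ (r + q) -> Y < 2 ^ r ->
  (forall k, sigma k = if a k == c k then out_shuffle n else in_shuffle n) ->
  nat_of_ord x = 2 ^ r * (\sum_(k < q) a k * 2 ^ k) + Y ->
  comp_all (fun k => sigma k : 'I_(2 * n) -> 'I_(2 * n)) x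
    = Y * 2 ^ q + \sum_(k < q) c k * 2 ^ k :> nat.
Proof.
elim: q r Y a c sigma => [|q IHq] r Y a c sigma n_eq ltY sigmaE x_eq.
  by rewrite /comp_all big_ord0 x_eq !big_ord0 muln0 muln1 addn0.
have {}n_eq : n = 2 ^ (r + q) by move: n_eq; rewrite addnS expnS; lia.
rewrite comp_all_recl sigmaE bits_recl.
set C := \sum_(k < q) _.
have ltC : C < 2 ^ q by apply: bits_lt.
(* Before the last shuffle the leading bit is [a ord0], followed by [Y] and the [q] target bits
   already rotated in. *)
rewrite (@shuffle_topbit n (a ord0) (c ord0) (Y * 2 ^ q + C)).
- by rewrite expnS; lia.
- by rewrite n_eq expnD; nia.
(* For the earlier shuffles [a ord0] heads the low word, now of length [r.+1]. *)
rewrite (IHq r.+1 (2 ^ r * a ord0 + Y) (fun k => a (lift ord0 k)) (fun k => c (lift ord0 k))).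
- by rewrite n_eq expnD -/C; nia.
- by rewrite {1}n_eq -expnS addSn.
- by rewrite expnS; case: (a ord0); lia.
- by move=> k; apply: sigmaE.
- by rewrite x_eq bits_recl expnS; nia.
Qed.

Theorem mainTheorem9 (p n : nat) (hp : 1 <= p) (hn : n = 2 ^ (p - 1))
  (i j : 'I_(2 * n)) (hij : i <> j)
  (ib jb : 'I_p -> bool)
  (hi : nat_of_ord i = \sum_(k < p) ib k * 2 ^ k)
  (hj : nat_of_ord j = \sum_(k < p) jb k * 2 ^ k)
  (sigma : 'I_p -> {perm 'I_(2 * n)})
  (hsigma : forall k : 'I_p,
     (ib k <> jb k -> sigma k = in_shuffle n) /\
     (ib k = jb k -> sigma k = out_shuffle n)) :
  comp_all (fun k : 'I_p => sigma k : 'I_(2 * n) -> 'I_(2 * n)) j = i /\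
  comp_all (fun k : 'I_p => sigma k : 'I_(2 * n) -> 'I_(2 * n)) i = j.
Proof.
have n_eq : 2 * n = 2 ^ (0 + p) by rewrite hn -expnS subn1 prednK.
have sigmaE k : sigma k = if ib k == jb k then out_shuffle n else in_shuffle n.
  by case: eqP => e; [apply: (hsigma k).2 | apply: (hsigma k).1].
split; apply: val_inj => /=.
  (* With [r = 0] the low word is empty and all [p] bits are replaced. The rule for [sigma] is
     symmetric in the two words. *)
  rewrite (@shuffles_replace_bits n p 0 0 jb ib) ?hi ?hj ?mul1n ?addn0 //.
  by move=> k; rewrite eq_sym.
by rewrite (@shuffles_replace_bits n p 0 0 ib jb) ?hi ?hj ?mul1n ?addn0.
Qed.
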